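(* Let $a,b,c>0$ be real numbers with $ab\neq1$, and let $x,y$ be real. For integers $m,n\ge 0$ define $$D^{(m)}_n(x,y;a,b,c)=\frac{1}{(\ln a+\ln b)^n}\sum_{k=0}^m\binom{m}{k}E^{(-k)}_n(x;a,b,c)\left(\frac{y\ln c+\ln a}{\ln a +\ln b}\right)^{m-k}.$$ Then, as formal power series in $t,u$, $$\sum_{n=0}^{\infty}\sum_{m=0}^{\infty}D^{(m)}_n(x,y;a,b,c)\frac{t^n}{n!}\frac{u^m}{m!}=\frac{2\,e^{\left(\frac{y\ln c+\ln a}{\ln a +\ln b}\right)u}\,e^{\left(\frac{x\ln c+\ln a}{\ln a +\ln b}\right)t}\,e^{t+u}\left(1-e^{-t}\right)}{(e^t+1)(e^t+e^u-e^{t+u})}.$$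
   Context: For an integer $k$ (possibly negative), ${\rm Li}_k(z)=\sum_{m\ge 1} z^m/m^k$ (a formal power series in $z$; e.g. ${\rm Li}_{-k}(z)=\sum_{m\ge1}m^kz^m$). For real $a,b,c>0$, $a^{-t}$ means $e^{-t\ln a}$, etc. The generalized poly-Euler polynomials $E^{(k)}_n(x;a,b,c)$ are defined by $$\frac{2\,{\rm Li}_k\big(1-(ab)^{-t}\big)}{a^{-t}+b^{t}}\,c^{xt}=\sum_{n=0}^{\infty}E^{(k)}_n(x;a,b,c)\frac{t^n}{n!}.$$ *)

(* Defs.v *)
From HB Require Import structures.
From mathcomp Require Import all_boot all_order all_algebra.
From mathcomp Require Import boolp reals exp.

Set Implicit Arguments.
Unset Strict Implicit.
Unset Printing Implicit Defensive.

Import Order.TTheory GRing.Theory Num.Theory.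
Local Open Scope ring_scope.

(** * Formal power series *)

(* A record rather than [nat -> R], whose canonical ring product is pointwise. *)
Record fps (R : Type) : Type := Fps { coefs : nat -> R }.

Notation "{ 'fps' R }" := (fps R) (at level 0, format "{ 'fps'  R }").

Lemma fpsP (R : Type) (f g : {fps R}) : coefs f =1 coefs g <-> f = g.
Proof.
by split=> [|-> //]; case: f g => [f] [g] /= fg; congr Fps; apply/funext.
Qed.

HB.instance Definition _ (R : Type) := gen_eqMixin {fps R}.
HB.instance Definition _ (R : Type) := gen_choiceMixin {fps R}.

Definition fps_add (R : zmodType) (f g : {fps R}) : {fps R} :=
  Fps (fun n => coefs f n + coefs g n).

Definition fps_opp (R : zmodType) (f : {fps R}) : {fps R} :=
  Fps (fun n => - coefs f n).

Definition fps_zero (R : zmodType) : {fps R} := Fps (fun=> 0).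

Fact fps_addA (R : zmodType) : associative (@fps_add R).
Proof. by move=> f g h; apply/fpsP => n /=; rewrite addrA. Qed.

Fact fps_addC (R : zmodType) : commutative (@fps_add R).
Proof. by move=> f g; apply/fpsP => n /=; rewrite addrC. Qed.

Fact fps_add0 (R : zmodType) : left_id (fps_zero R) (@fps_add R).
Proof. by move=> f; apply/fpsP => n /=; rewrite add0r. Qed.

Fact fps_addN (R : zmodType) :
  left_inverse (fps_zero R) (@fps_opp R) (@fps_add R).
Proof. by move=> f; apply/fpsP => n /=; rewrite addNr. Qed.

HB.instance Definition _ (R : zmodType) :=
  GRing.isZmodule.Build {fps R}
    (@fps_addA R) (@fps_addC R) (@fps_add0 R) (@fps_addN R).

Definition fpsC (R : zmodType) (c : R) : {fps R} :=
  Fps (fun n => if n == 0%N then c else 0).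

Definition fps_mul (R : comNzRingType) (f g : {fps R}) : {fps R} :=
  Fps (fun n => \sum_(i < n.+1) coefs f i * coefs g (n - i)%N).

Definition fps_trunc (R : comNzRingType) (N : nat) (f : {fps R}) : {poly R} :=
  \poly_(i < N) coefs f i.

Lemma coef_fps_trunc (R : comNzRingType) N (f : {fps R}) n :
  (n < N)%N -> (fps_trunc N f)`_n = coefs f n.
Proof. by move=> nN; rewrite coef_poly nN. Qed.

Lemma coefs_mul_trunc (R : comNzRingType) N (f g : {fps R}) n : (n < N)%N ->
  coefs (fps_mul f g) n = (fps_trunc N f * fps_trunc N g)`_n.
Proof.
move=> nN; rewrite coefM /=; apply: eq_bigr => i _.
rewrite !coef_fps_trunc //; first by rewrite (leq_ltn_trans (leq_subr _ _)).
by rewrite (leq_ltn_trans _ nN) // -ltnS.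
Qed.

Fact fps_mulC (R : comNzRingType) : commutative (@fps_mul R).
Proof.
by move=> f g; apply/fpsP => n; rewrite !(@coefs_mul_trunc _ n.+1) // mulrC.
Qed.

Fact fps_mulA (R : comNzRingType) : associative (@fps_mul R).
Proof.
have trM (f g : {fps R}) n i : (i < n.+1)%N ->
    coefs (fps_mul f g) i = (fps_trunc n.+1 f * fps_trunc n.+1 g)`_i.
  exact: coefs_mul_trunc.
move=> f g h; apply/fpsP => n.
transitivity ((fps_trunc n.+1 f * (fps_trunc n.+1 g * fps_trunc n.+1 h))`_n).
  rewrite coefM; apply: eq_bigr => i _.
  by rewrite (@trM g h n) ?coef_fps_trunc // ltnS leq_subr.
rewrite mulrA coefM; apply: eq_bigr => i _.
by rewrite (@trM f g n) ?coef_fps_trunc // ltnS leq_subr.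
Qed.

Fact fps_mul1 (R : comNzRingType) : left_id (fpsC (1 : R)) (@fps_mul R).
Proof.
move=> f; apply/fpsP => n /=; rewrite big_ord_recl /= mul1r subn0.
by rewrite big1 ?addr0 // => i _; rewrite mul0r.
Qed.

Fact fps_mulDl (R : comNzRingType) : left_distributive (@fps_mul R) +%R.
Proof.
move=> f g h; apply/fpsP => n /=; rewrite -big_split /=.
by apply: eq_bigr => i _; rewrite mulrDl.
Qed.

Fact fps_one_neq0 (R : comNzRingType) : fpsC (1 : R) != 0.
Proof.
by apply/eqP => /fpsP /(_ 0%N) /= /eqP; rewrite (negPf (oner_neq0 R)).
Qed.

HB.instance Definition _ (R : comNzRingType) :=
  GRing.Zmodule_isComNzRing.Build {fps R}
    (@fps_mulA R) (@fps_mulC R) (@fps_mul1 R) (@fps_mulDl R) (fps_one_neq0 R).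

Lemma coefsD (R : zmodType) (f g : {fps R}) n :
  coefs (f + g) n = coefs f n + coefs g n.
Proof. by []. Qed.

Lemma coefsN (R : zmodType) (f : {fps R}) n : coefs (- f) n = - coefs f n.
Proof. by []. Qed.

Lemma coefs0 (R : zmodType) n : coefs (0 : {fps R}) n = 0.
Proof. by []. Qed.

Lemma coefs1 (R : comNzRingType) n :
  coefs (1 : {fps R}) n = if n == 0%N then 1 else 0.
Proof. by []. Qed.

Lemma coefsM (R : comNzRingType) (f g : {fps R}) n :
  coefs (f * g) n = \sum_(i < n.+1) coefs f i * coefs g (n - i)%N.
Proof. by []. Qed.

Lemma coefs_sum (R : zmodType) (I : Type) (r : seq I) (P : pred I)
    (F : I -> {fps R}) n :
  coefs (\sum_(i <- r | P i) F i) n = \sum_(i <- r | P i) coefs (F i) n.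
Proof. by elim/big_rec2: _ => // i f c _ <-. Qed.

Lemma coefsCM (R : comNzRingType) (c : R) (f : {fps R}) n :
  coefs (fpsC c * f) n = c * coefs f n.
Proof.
rewrite coefsM big_ord_recl /= subn0 big1 ?addr0 // => i _.
by rewrite mul0r.
Qed.

Lemma coefsX_lt (R : comNzRingType) (f : {fps R}) k n :
  coefs f 0%N = 0 -> (n < k)%N -> coefs (f ^+ k) n = 0.
Proof.
move=> f0; elim: k n => [//|k IH] n nk; rewrite exprS coefsM big1 // => i _.
case: (posnP i) => [->|i_gt0]; first by rewrite f0 mul0r.
by rewrite IH ?mulr0 //; have := ltn_ord i; case: (i : nat) i_gt0 => // j _ jn;
   rewrite ltn_subLR ?(leq_trans nk) // ?addSn ?ltnS ?leq_addl // -ltnS.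
Qed.

(* The substitution [f(g)]; the finite sum is the coefficient of the
   composition because [g] is required to have constant coefficient 0, so that
   [g ^+ k] contributes nothing in degree [n < k]. *)
Definition fps_subst (R : comNzRingType) (f g : {fps R}) : {fps R} :=
  Fps (fun n => \sum_(k < n.+1) coefs f k * coefs (g ^+ k) n).

Definition fps_unit (R : comUnitRingType) : {pred {fps R}} :=
  fun f => coefs f 0%N \is a GRing.unit.

(* [f = c (1 - h)] with [c] the constant coefficient, so that
   [1/f = c^-1 (1 + h + h^2 + ...)]. *)
Definition fps_inv (R : comUnitRingType) (f : {fps R}) : {fps R} :=
  if f \in @fps_unit R then
    let d := fpsC (coefs f 0%N)^-1 in
    d * fps_subst (Fps (fun=> 1)) (1 - d * f)
  else f.

Fact fps_mulVx (R : comUnitRingType) :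
  {in @fps_unit R, left_inverse 1 (@fps_inv R) *%R}.
Proof.
move=> f uf; rewrite /fps_inv uf; set d := fpsC _; set h := 1 - d * f.
have h0 : coefs h 0%N = 0.
  by rewrite coefsD coefsN coefsCM coefs1 /= mulVr ?subrr.
rewrite mulrAC; have -> : d * f = 1 - h by rewrite /h opprB addrC subrK.
apply/fpsP => n.
have coefG i : (i < n.+1)%N -> coefs (fps_subst (Fps (fun=> 1)) h) i =
    coefs (\sum_(k < n.+1) h ^+ k) i.
  move=> lin; rewrite coefs_sum /=.
  rewrite (big_ord_widen n.+1 (fun k => 1 * coefs (h ^+ k) i)) // big_mkcond /=.
  apply: eq_bigr => k _; case: ltnP => [|ik]; first by rewrite mul1r.
  by rewrite coefsX_lt.
transitivity (coefs ((1 - h) * \sum_(k < n.+1) h ^+ k) n).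
  by rewrite !coefsM; apply: eq_bigr => i _; rewrite coefG // ltnS leq_subr.
have -> : (1 - h) * (\sum_(k < n.+1) h ^+ k) = 1 - h ^+ n.+1.
  by rewrite -opprB mulNr -subrX1 opprB.
by rewrite coefsD coefsN coefsX_lt // subr0.
Qed.

Fact fps_unitPl (R : comUnitRingType) (f g : {fps R}) :
  g * f = 1 -> fps_unit f.
Proof.
move=> /fpsP /(_ 0%N); rewrite coefsM big_ord1 subnn => gf.
by apply/unitrPr; exists (coefs g 0%N); rewrite mulrC gf.
Qed.

Fact fps_inv_out (R : comUnitRingType) :
  {in [predC @fps_unit R], @fps_inv R =1 id}.
Proof. by move=> f; rewrite /fps_inv inE => /negPf ->. Qed.

HB.instance Definition _ (R : comUnitRingType) :=
  GRing.ComNzRing_hasMulInverse.Build {fps R}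
    (@fps_mulVx R) (@fps_unitPl R) (@fps_inv_out R).

Lemma fps_unitE (R : comUnitRingType) (f : {fps R}) :
  (f \is a GRing.unit) = (coefs f 0%N \is a GRing.unit).
Proof. by []. Qed.

Definition fpsX (R : comNzRingType) : {fps R} :=
  Fps (fun n => if n == 1%N then 1 else 0).

(** * Two variables: [R[[t, u]]] is [{fps {fps R}}], that is [R[[u]][[t]]];
    the coefficient of [t^n u^m] in [F] is [coefs (coefs F n) m]. *)

Definition fps2_t (R : comNzRingType) : {fps {fps R}} := fpsX {fps R}.
Definition fps2_u (R : comNzRingType) : {fps {fps R}} := fpsC (fpsX R).
Definition fps2C (R : comNzRingType) (c : R) : {fps {fps R}} := fpsC (fpsC c).

(* [f(G)] for [G] with constant coefficient 0; [G ^+ k] then only has terms of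
   total degree at least [k]. *)
Definition fps2_subst (R : comNzRingType) (f : {fps R}) (G : {fps {fps R}}) :
    {fps {fps R}} :=
  Fps (fun n => Fps (fun m =>
    \sum_(k < (n + m).+1) coefs f k * coefs (coefs (G ^+ k) n) m)).

(** * Exponentials and polylogarithms *)

Definition fps_expS (R : comUnitRingType) : {fps R} :=
  Fps (fun n => (n`!%:R)^-1).

Definition fps_exp (R : comUnitRingType) (g : {fps R}) : {fps R} :=
  fps_subst (fps_expS R) g.

Definition fps2_exp (R : comUnitRingType) (G : {fps {fps R}}) :
    {fps {fps R}} :=
  fps2_subst (fps_expS R) G.

(* [a^(r t) = e^(r t ln a)] as a series in [t] *)
Definition fps_pow (R : realType) (a r : R) : {fps R} :=
  fps_exp (fpsC (r * ln a) * fpsX R).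

Lemma coefs_fps_pow0 (R : realType) (a r : R) : coefs (fps_pow a r) 0%N = 1.
Proof. by rewrite /= big_ord1 expr0 /= invr1 mulr1. Qed.

Lemma coefs_fps2_exp00 (R : comUnitRingType) (G : {fps {fps R}}) :
  coefs (coefs (fps2_exp G) 0%N) 0%N = 1.
Proof. by rewrite /= big_ord1 expr0 /= invr1 mulr1. Qed.

Definition Li (R : realType) (k : int) : {fps R} :=
  Fps (fun m => if m == 0%N then 0 else ((m%:R : R) ^ k)^-1).

(** * Generalized poly-Euler polynomials *)

Definition polyEuler_gf (R : realType) (k : int) (x a b c : R) : {fps R} :=
  2 * fps_subst (Li R k) (1 - fps_pow (a * b) (-1))
    / (fps_pow a (-1) + fps_pow b 1) * fps_pow c x.

Lemma polyEuler_gf_den_unit (R : realType) (a b : R) :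
  fps_pow a (-1) + fps_pow b 1 \is a GRing.unit.
Proof. by rewrite fps_unitE coefsD !coefs_fps_pow0 unitfE (pnatr_eq0 R 2). Qed.

Definition polyEuler (R : realType) (k : int) (n : nat) (x a b c : R) : R :=
  n`!%:R * coefs (polyEuler_gf k x a b c) n.

Lemma polyEuler_gfE (R : realType) (k : int) (x a b c : R) :
  polyEuler_gf k x a b c = Fps (fun n => polyEuler k n x a b c / n`!%:R).
Proof.
apply/fpsP => n; rewrite [RHS]/= /polyEuler mulrAC mulfV ?mul1r //.
by rewrite pnatr_eq0 -lt0n fact_gt0.
Qed.

Definition Dmn (R : realType) (m n : nat) (x y a b c : R) : R :=
  1 / (ln a + ln b) ^+ n *
  \sum_(0 <= k < m.+1)
    'C(m, k)%:R * polyEuler (- k%:Z) n x a b c *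
    ((y * ln c + ln a) / (ln a + ln b)) ^+ (m - k).

Lemma Dmn_gf_den_unit (R : realType) (t := fps2_t R) (u := fps2_u R)
    (e := @fps2_exp R) :
  (e t + 1) * (e t + e u - e (t + u)) \is a GRing.unit.
Proof.
have e0 G : coefs (coefs (e G) 0%N) 0%N = 1 := coefs_fps2_exp00 G.
clearbody e t u.
rewrite unitrM.
rewrite (fps_unitE (e t + 1)).
rewrite (fps_unitE (e t + e u - _)).
rewrite (coefsD (e t)).
rewrite (fps_unitE (coefs (e t) _ + _)).
rewrite (coefsD (coefs (e t) _)) e0.
rewrite (coefsD (e t + e u)) (coefsD (e t)) (coefsN (e _)).
rewrite fps_unitE (coefsD (_ + _)) (coefsD (coefs (e t) _)) coefsN !e0.
by rewrite addrK unitr1 unitfE (pnatr_eq0 R 2).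
Qed.

(* Main.v *)
From HB Require Import structures.
Require Import Defs.
From mathcomp Require Import all_boot all_order all_algebra.
From mathcomp Require Import boolp reals exp.
From mathcomp Require Import ring.

Set Implicit Arguments.
Unset Strict Implicit.
Unset Printing Implicit Defensive.

Import Order.TTheory GRing.Theory Num.Theory.
Local Open Scope ring_scope.

(** Put [L = ln a + ln b] and rescale [t] by [1/L]: since
    [a^(-t/L) + b^(t/L) = e^(-t ln a / L) (1 + e^t)], the generating function
    of [E^(-k)_n / L^n] is [2 Li_{-k}(1 - e^-t) e^(X t) / (1 + e^t)].  The
    binomial sum over [k] is the product with [e^(Y u)], and with
    [z = 1 - e^-t] the remaining sum over [k] is a geometric series:
    [\sum_k Li_{-k}(z) u^k / k! = \sum_(j >= 1) (z e^u)^j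
       = z e^u / (1 - z e^u)]. *)

(** * Ring morphisms between power series rings, and the geometric series *)

Lemma fpsC_is_zmod_morphism (R : zmodType) : zmod_morphism (@fpsC R).
Proof.
move=> r s; apply/fpsP => n; rewrite coefsD coefsN /=.
by case: eqP => // _; rewrite subr0.
Qed.

HB.instance Definition _ (R : zmodType) :=
  GRing.isZmodMorphism.Build R {fps R} (@fpsC R) (@fpsC_is_zmod_morphism R).

Lemma fpsC_is_monoid_morphism (R : comNzRingType) : monoid_morphism (@fpsC R).
Proof.
split=> // r s; apply/fpsP => n; rewrite coefsCM /=.
by case: eqP => // _; rewrite mulr0.
Qed.

HB.instance Definition _ (R : comNzRingType) :=
  GRing.isMonoidMorphism.Build R {fps R} (@fpsC R)
    (@fpsC_is_monoid_morphism R).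

Lemma coefsXn (R : comNzRingType) k n :
  coefs (fpsX R ^+ k) n = (n == k)%:R.
Proof.
elim: k n => [|k IH] n; first by rewrite expr0 coefs1; case: eqP.
rewrite exprS coefsM; case: n => [|n].
  by rewrite big_ord1 /= mul0r.
rewrite big_ord_recl big_ord_recl /= mul0r add0r mul1r big1 ?addr0.
  by rewrite subSS subn0 IH.
by move=> i _; rewrite mul0r.
Qed.

(** At [phi := fpsC] this is the inclusion of R[[t]] into R[[t, u]], while [fpsC] itself includes
    R[[u]]. *)
Definition fps_map {R S : comNzRingType} (phi : {rmorphism R -> S})
  (f : {fps R}) : {fps S} := Fps (fun n => phi (coefs f n)).

Lemma fps_map_is_zmod_morphism (R S : comNzRingType)
  (phi : {rmorphism R -> S}) : zmod_morphism (fps_map phi).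
Proof. by move=> f g; apply/fpsP => n; rewrite /= rmorphB. Qed.

HB.instance Definition _ (R S : comNzRingType) (phi : {rmorphism R -> S}) :=
  GRing.isZmodMorphism.Build {fps R} {fps S} (fps_map phi)
    (fps_map_is_zmod_morphism phi).

Lemma fps_map_is_monoid_morphism (R S : comNzRingType)
  (phi : {rmorphism R -> S}) : monoid_morphism (fps_map phi).
Proof.
split=> [|f g]; apply/fpsP => n /=.
  by case: eqP => _; rewrite ?rmorph0 ?rmorph1.
by rewrite rmorph_sum; apply: eq_bigr => i _; rewrite rmorphM.
Qed.

HB.instance Definition _ (R S : comNzRingType) (phi : {rmorphism R -> S}) :=
  GRing.isMonoidMorphism.Build {fps R} {fps S} (fps_map phi)
    (fps_map_is_monoid_morphism phi).

(** Substitution of s t for t, given directly on coefficients so that the morphism laws are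
    immediate for every [s]. With s = 1/L it absorbs the factor 1/L^n of [Dmn]. *)
Definition fps_scale {R : comNzRingType} (s : R) (f : {fps R}) : {fps R} :=
  Fps (fun n => s ^+ n * coefs f n).

Lemma fps_scale_is_zmod_morphism (R : comNzRingType) (s : R) :
  zmod_morphism (fps_scale s).
Proof. by move=> f g; apply/fpsP => n; rewrite /= mulrBr. Qed.

HB.instance Definition _ (R : comNzRingType) (s : R) :=
  GRing.isZmodMorphism.Build {fps R} {fps R} (fps_scale s)
    (fps_scale_is_zmod_morphism s).

Lemma fps_scale_is_monoid_morphism (R : comNzRingType) (s : R) :
  monoid_morphism (fps_scale s).
Proof.
split=> [|f g]; apply/fpsP => n /=.
  by case: eqP => [->|_]; rewrite ?mulr0 // expr0 mulr1.
rewrite mulr_sumr; apply: eq_bigr => i _.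
have /subnKC {1}<- : (i <= n)%N by rewrite -ltnS.
by rewrite exprD mulrACA.
Qed.

HB.instance Definition _ (R : comNzRingType) (s : R) :=
  GRing.isMonoidMorphism.Build {fps R} {fps R} (fps_scale s)
    (fps_scale_is_monoid_morphism s).

Lemma fps_scale_subst (R : comNzRingType) (s : R) (f g : {fps R}) :
  fps_scale s (fps_subst f g) = fps_subst f (fps_scale s g).
Proof.
apply/fpsP => n /=; rewrite mulr_sumr; apply: eq_bigr => k _.
by rewrite -rmorphXn /= mulrCA.
Qed.

(** Since 1 - w has constant coefficient 1, [fps_inv] of it unfolds to exactly this series. *)
Lemma fps_subst_geometric (R : comUnitRingType) (w : {fps R}) :
  coefs w 0%N = 0 -> (1 - w) * fps_subst (Fps (fun=> 1)) w = 1.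
Proof.
move=> w0.
have w1 : coefs (1 - w) 0%N = 1 by rewrite coefsD coefsN w0 subr0.
have uw : 1 - w \in @fps_unit R by rewrite unfold_in w1 unitr1.
have := fps_mulVx uw.
rewrite /fps_inv uw w1 invr1 (rmorph1 (@fpsC R)) !mul1r.
by rewrite opprB addrC subrK mulrC.
Qed.

(** * The exponential series e^(r t) in one variable *)

Lemma fact_neq0 (R : numFieldType) n : (n`!%:R : R) != 0.
Proof. by rewrite pnatr_eq0 -lt0n fact_gt0. Qed.

Definition expT {R : numFieldType} (r : R) : {fps R} :=
  Fps (fun n => r ^+ n / n`!%:R).

Lemma binomial_fact (R : numFieldType) n k : (k <= n)%N ->
  ('C(n, k)%:R : R) / n`!%:R = (k`!%:R)^-1 * ((n - k)`!%:R)^-1.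
Proof.
move=> kn; rewrite -(bin_fact kn) !natrM.
have C0 : ('C(n, k)%:R : R) != 0 by rewrite pnatr_eq0 -lt0n bin_gt0.
by field; rewrite C0 !fact_neq0.
Qed.

Lemma expTD (R : numFieldType) (r s : R) : expT (r + s) = expT r * expT s.
Proof.
apply/fpsP => n /=; rewrite addrC exprDn mulr_suml; apply: eq_bigr => i _.
have le_in : (i <= n)%N by rewrite -ltnS.
rewrite -mulr_natr -[LHS]mulrA binomial_fact // [s ^+ _ * r ^+ _]mulrC.
by rewrite [RHS]mulrACA.
Qed.

Lemma expT0 (R : numFieldType) : expT (0 : R) = 1.
Proof.
apply/fpsP => -[|n]; first by rewrite /= expr0 invr1 mulr1.
by rewrite /= expr0n mul0r.
Qed.

Lemma expT_nat (R : numFieldType) j : expT (j%:R : R) = expT 1 ^+ j.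
Proof.
elim: j => [|j IH]; first exact: expT0.
by rewrite -natr1 expTD IH exprSr.
Qed.

Lemma fps_scale_expT (R : numFieldType) (s r : R) :
  fps_scale s (expT r) = expT (s * r).
Proof. by apply/fpsP => n; rewrite /= exprMn mulrA. Qed.

(** The power (r t)^k lives in degree k only, so the sum defining the coefficient of degree n
    reduces to its last index k = n. *)
Lemma fps_expE (R : numFieldType) (r : R) : fps_exp (fpsC r * fpsX R) = expT r.
Proof.
apply/fpsP => n /=; rewrite (bigD1 ord_max) //= big1 ?addr0.
  by rewrite exprMn -rmorphXn coefsCM coefsXn eqxx mulr1 mulrC.
move=> i ne_in; rewrite exprMn -rmorphXn coefsCM coefsXn.
by rewrite eq_sym (negPf ne_in : (i : nat) == n = false) !mulr0.
Qed.

(** * Exponentials in two variables *)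

(* [f(t)] as a series in [t] and [u] *)
Local Notation lift := (fps_map (@fpsC _)).

Lemma fps2_exp_t (R : numFieldType) (r : R) :
  fps2_exp (fps2C r * fps2_t R) = lift (expT r).
Proof.
apply/fpsP => n; apply/fpsP => m.
have G k : coefs (coefs ((fps2C r * fps2_t R) ^+ k) n) m =
    if (m == 0%N) && (n == k) then r ^+ k else 0.
  rewrite /fps2C /fps2_t exprMn -!rmorphXn (coefsCM _ (fpsX _ ^+ k)) coefsXn.
  rewrite coefsCM; case: (n == k); last by rewrite andbF mulr0.
  by rewrite andbT coefs1; case: eqP; rewrite ?mulr1 ?mulr0.
rewrite /=; case: m G => [|m] G.
  rewrite addn0 (bigD1 ord_max) //= G /= eqxx big1 ?addr0;
    first by rewrite mulrC.
  by move=> i ne_in; rewrite G eq_sym (negPf ne_in : (i : nat) == n = false)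
    mulr0.
by rewrite big1 // => i _; rewrite G mulr0.
Qed.

Lemma fps2_exp_u (R : numFieldType) (r : R) :
  fps2_exp (fps2C r * fps2_u R) = fpsC (expT r).
Proof.
apply/fpsP => n; apply/fpsP => m.
have G k : coefs (coefs ((fps2C r * fps2_u R) ^+ k) n) m =
    if (n == 0%N) && (m == k) then r ^+ k else 0.
  rewrite /fps2C /fps2_u -rmorphM -rmorphXn /= exprMn -rmorphXn /=.
  case: eqP => // _; rewrite coefsCM coefsXn.
  by case: (m == k); rewrite ?mulr1 ?mulr0.
rewrite /=; case: n G => [|n] G.
  rewrite add0n (bigD1 ord_max) //= G /= eqxx big1 ?addr0;
    first by rewrite mulrC.
  by move=> i ne_in; rewrite G eq_sym (negPf ne_in : (i : nat) == m = false)
    mulr0.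
by rewrite big1 // => i _; rewrite G mulr0.
Qed.

Lemma coefs_lift_fpsC (R : numFieldType) (f g : {fps R}) n m :
  coefs (coefs (lift f * fpsC g) n) m = coefs f n * coefs g m.
Proof. by rewrite mulrC coefsCM mulrC coefsCM. Qed.

(** By the binomial theorem t^n u^m occurs in (t + u)^k only for k = n + m, the last index of the
    sum in [fps2_subst], with coefficient C(n + m, n). Dividing by (n + m)! leaves 1 / (n! m!). *)
Lemma fps2_exp_tu (R : numFieldType) :
  fps2_exp (fps2_t R + fps2_u R) = lift (expT (1 : R)) * fpsC (expT (1 : R)).
Proof.
apply/fpsP => n; apply/fpsP => m; rewrite coefs_lift_fpsC.
have G k : coefs (coefs ((fps2_t R + fps2_u R) ^+ k) n) m =
    if k == (n + m)%N then 'C(n + m, n)%:R else 0.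
  rewrite addrC exprDn coefs_sum coefs_sum.
  have H (i : 'I_k.+1) :
      coefs (coefs ((fps2_u R ^+ (k - i) * fps2_t R ^+ i) *+ 'C(k, i)) n) m =
      if (n == i) && (m == (k - i)%N) then 'C(k, i)%:R else 0.
    rewrite /fps2_u -rmorphXn -mulr_natl -(rmorph_nat (@fpsC {fps R})) mulrA.
    rewrite -rmorphM (coefsCM _ (fps2_t R ^+ i)) coefsXn.
    case: (n == i); last by rewrite mulr0.
    rewrite mulr1 -(rmorph_nat (@fpsC R)) coefsCM coefsXn /=.
    by case: eqP; rewrite ?mulr1 ?mulr0.
  rewrite (eq_bigr _ (fun i _ => H i)).
  case: eqP => [->|nk].
    (* The only surviving binomial term is the one of index i = n. *)
    have ltn : (n < (n + m).+1)%N by rewrite ltnS leq_addr.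
    rewrite (bigD1 (Ordinal ltn)) //= eqxx addKn eqxx big1 ?addr0 // => i ne_i.
    by rewrite eq_sym (negPf ne_i : (i : nat) == n = false).
  apply: big1 => i _; case: eqP => //= ni; case: eqP => // mi.
  by case: nk; rewrite ni mi subnKC // -ltnS.
rewrite /= (bigD1 ord_max) //= G eqxx big1 ?addr0.
  by rewrite !expr1n !div1r mulrC binomial_fact ?leq_addr // addKn.
move=> i ne_i.
by rewrite G (negPf ne_i : (i : nat) == (n + m)%N = false) mulr0.
Qed.

(** * Exponential generating functions in u *)

(* [\sum_k P_k u^k / k!] *)
Definition fps2_egf {R : numFieldType} (P : nat -> {fps R}) : {fps {fps R}} :=
  Fps (fun n => Fps (fun k => coefs (P k) n / k`!%:R)).

Lemma fps2_egf_mulr (R : numFieldType) (P : nat -> {fps R}) (f : {fps R}) :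
  fps2_egf P * lift f = fps2_egf (fun k => P k * f).
Proof.
apply/fpsP => n; apply/fpsP => k; rewrite coefsM coefs_sum [RHS]/= mulr_suml.
by apply: eq_bigr => i _; rewrite [X in coefs X k]mulrC coefsCM /=
  [LHS]mulrC mulrAC.
Qed.

(** The Cauchy product of exponential generating functions is binomial convolution; s = (y ln c + ln
    a) / L yields the inner sum of [Dmn]. *)
Lemma fps2_egf_mul_expT (R : numFieldType) (P : nat -> {fps R}) (s : R) :
  fps2_egf P * fpsC (expT s) =
  fps2_egf (fun m => Fps (fun n =>
    \sum_(0 <= k < m.+1) 'C(m, k)%:R * coefs (P k) n * s ^+ (m - k))).
Proof.
apply/fpsP => n; apply/fpsP => m; rewrite mulrC coefsCM mulrC coefsM.
rewrite [RHS]/= big_mkord mulr_suml; apply: eq_bigr => k _ /=.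
have le_km : (k <= m)%N by rewrite -ltnS.
rewrite -['C(m, k)%:R * _ * _]mulrA [RHS]mulrAC binomial_fact //.
by rewrite [RHS]mulrC mulrACA.
Qed.

(** With w = z e^u one has w^j = z^j e^(j u), whose coefficient at u^k is z^j j^k / k!. Summing over
    j >= 1 gives Li_(-k)(z) / k!, so the left-hand family is the geometric series in w without its
    term j = 0. *)
Lemma fps2_egf_Li (R : realType) (z : {fps R}) : coefs z 0%N = 0 ->
  (1 - lift z * fpsC (expT (1 : R))) *
    fps2_egf (fun k => fps_subst (Li R (- k%:Z)) z) =
  lift z * fpsC (expT (1 : R)).
Proof.
move=> z0; set w := lift z * _.
have w0 : coefs w 0%N = 0.
  rewrite /w coefsM big_ord1 /= z0 (rmorph0 (@fpsC R)).
  by rewrite mul0r.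
suff -> : fps2_egf (fun k => fps_subst (Li R (- k%:Z)) z) =
          fps_subst (Fps (fun=> 1)) w - 1.
  by rewrite mulrBr fps_subst_geometric // mulr1 opprB addrC subrK.
apply/fpsP => n; apply/fpsP => k.
have wj j : coefs (coefs (w ^+ j) n) k =
    coefs (z ^+ j) n * (j%:R ^+ k / k`!%:R).
  by rewrite /w exprMn -(rmorphXn lift) -(rmorphXn (@fpsC _)) -expT_nat
    coefs_lift_fpsC.
rewrite (coefsD (fps_subst _ w)) (coefsN 1) coefsD coefsN.
have -> : coefs (coefs (fps_subst (Fps (fun=> 1)) w) n) k =
    \sum_(j < n.+1) coefs (z ^+ j) n * (j%:R ^+ k / k`!%:R).
  rewrite /= coefs_sum; apply: eq_bigr => j _.
  by rewrite mul1r wj.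
rewrite /= big_ord_recl [in RHS]big_ord_recl /= mul0r add0r.
(* The term j = 0 is paired with the subtracted 1: since 0^0 = 1 they cancel in degree (0, 0), and
   both vanish elsewhere. *)
rewrite addrAC -[LHS]add0r; congr (_ + _).
  case: eqP => _ /=; last by rewrite mul0r subrr.
  by case: k {wj} => [|k]; rewrite ?expr0 ?fact0 ?divr1 ?mulr1 ?subrr
    // expr0n !mul0r mulr0 subrr.
rewrite mulr_suml; apply: eq_bigr => j _ /=.
by rewrite -exprnN invrK mulrAC mulrC.
Qed.

(** * The rescaled generating function of the poly-Euler polynomials *)

Lemma fps_powE (R : realType) (a r : R) : fps_pow a r = expT (r * ln a).
Proof. exact: fps_expE. Qed.

(** Clearing the denominator first lets the rescaling act as a ring morphism on both sides. The
    factor e^(-t ln a / L) split off the denominator is what adds ln a to x ln c in the exponent. *)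
Lemma polyEuler_gf_scaled (R : realType) (k : int) (x a b c : R) :
    0 < a -> 0 < b -> a * b != 1 ->
  fps_scale (ln a + ln b)^-1 (polyEuler_gf k x a b c) * (expT (1 : R) + 1) =
  fps_subst (Li R k) (1 - expT (-1 : R)) *
    (2 * expT ((x * ln c + ln a) / (ln a + ln b))).
Proof.
move=> a0 b0 ab; set L := ln a + ln b.
(* L = ln (a b), which vanishes only at a b = 1. *)
have L0 : L != 0.
  by rewrite /L -lnM ?posrE // ln_eq0 ?mulr_gt0.
have := polyEuler_gf_den_unit a b.
set D := _ + _ => uD.
have : polyEuler_gf k x a b c * D =
    2 * fps_subst (Li R k) (1 - fps_pow (a * b) (-1)) * fps_pow c x.
  by rewrite /polyEuler_gf -/D mulrAC divrK.
move: (polyEuler_gf _ _ _ _ _) => F /(congr1 (fps_scale L^-1)).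
rewrite /D !fps_powE lnM ?posrE // -/L !rmorphM (rmorph_nat _ 2).
rewrite (rmorphD _ (expT _)) /= fps_scale_subst rmorphB rmorph1.
rewrite /= !fps_scale_expT.
rewrite (_ : L^-1 * (-1 * L) = -1) ?mul1r ?mulN1r; last by field.
(* This exhibits A = e^(-t ln a / L) as a common factor of the two summands of the denominator. *)
have -> : L^-1 * ln b = L^-1 * - ln a + 1 by rewrite /L in L0 *; field.
set P := fps_scale _ _; set S := fps_subst _ _.
rewrite (_ : (x * ln c + ln a) / L = L^-1 * (x * ln c) - L^-1 * - ln a);
  last by field.
rewrite !expTD; set A := expT (L^-1 * - ln a); set B := expT (- _) => H.
have AB : A * B = 1 by rewrite -expTD subrr expT0.
(* Multiplying by B, the inverse of A, cancels that common factor. *)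
transitivity (P * (A + A * expT (1 : R)) * B); last by rewrite H; ring.
transitivity (P * (expT (1 : R) + 1) * (A * B)); last by ring.
by rewrite AB mulr1.
Qed.

(** * Elimination of the denominators and conclusion *)

(** Here [et], [eu], [em] stand for e^t, e^u, e^(-t). The point is e^t + e^u - e^(t+u) = e^t (1 - w)
    with w = (1 - e^(-t)) e^u: the factor 1 - w turns [S] into w. *)
Lemma gf_quotient_from_factors (A : comUnitRingType)
    (F G S d1 d2 w ey ex et eu em : A) :
    d1 * d2 \is a GRing.unit -> F = G * ey ->
    G * d1 = S * (2 * ex) -> (1 - w) * S = w ->
    w = (1 - em) * eu -> em * et = 1 -> d2 = et + eu - et * eu ->
  F = 2 * ey * ex * (et * eu) * (1 - em) / (d1 * d2).
Proof.
move=> ud -> Gd Sw wE emt d2E; apply: (mulIr ud); rewrite divrK //.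
have d2w : d2 = et * (1 - w).
  rewrite wE d2E; transitivity (et + (em * et) * eu - et * eu); last by ring.
  by rewrite emt mul1r.
transitivity (G * d1 * ey * d2); first by ring.
rewrite Gd d2w.
transitivity (((1 - w) * S) * (2 * ex) * ey * et); first by ring.
by rewrite Sw wE; ring.
Qed.

Theorem theorem2p4 (R : realType) (a b c x y : R)
    (a_gt0 : 0 < a) (b_gt0 : 0 < b) (c_gt0 : 0 < c) (ab_neq1 : a * b != 1) :
  let t := fps2_t R in
  let u := fps2_u R in
  let e := @fps2_exp R in
  let X := fps2C ((x * ln c + ln a) / (ln a + ln b)) in
  let Y := fps2C ((y * ln c + ln a) / (ln a + ln b)) in
  Fps (fun n => Fps (fun m => Dmn m n x y a b c / n`!%:R / m`!%:R)) =
  2 * e (Y * u) * e (X * t) * e (t + u) * (1 - e (- t))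
    / ((e t + 1) * (e t + e u - e (t + u))).
Proof.
move=> t u e X Y.
have : (e t + 1) * (e t + e u - e (t + u)) \is a GRing.unit.
  exact: Dmn_gf_den_unit.
have E1 : e t = lift (expT (1 : R)).
  by rewrite -fps2_exp_t /fps2C !rmorph1 mul1r.
have E2 : e u = fpsC (expT (1 : R)).
  by rewrite -fps2_exp_u /fps2C !rmorph1 mul1r.
have E3 : e (- t) = lift (expT (-1 : R)).
  by rewrite -fps2_exp_t /fps2C !rmorphN !rmorph1 mulN1r.
rewrite [e (Y * u)]fps2_exp_u [e (X * t)]fps2_exp_t [e (t + u)]fps2_exp_tu.
rewrite E1 E2 E3 => den_unit.
have z0 : coefs (1 - expT (-1 : R)) 0%N = 0.
  by rewrite coefsD coefsN /= expr0 invr1 mulr1 subrr.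
(* The coefficient of t^n in [P k] is E^(-k)_n / (L^n n!). *)
pose P k := fps_scale (ln a + ln b)^-1 (polyEuler_gf (- k%:Z) x a b c).
have PE k n : coefs (P k) n =
    (ln a + ln b) ^- n * (polyEuler (- k%:Z) n x a b c / n`!%:R).
  by rewrite /P polyEuler_gfE /= exprVn.
have PM k : P k * (expT 1 + 1) = _ :=
  polyEuler_gf_scaled (- k%:Z) x c a_gt0 b_gt0 ab_neq1.
clearbody P.
(* [S] is the series of the Li_(-k)(1 - e^(-t)) u^k / k!, with its geometric relation supplied by
   [fps2_egf_Li]. The first two goals left are the binomial sum over k and the relation of [P k] to
   Li_(-k), summed over k. *)
apply: (gf_quotient_from_factors (G := fps2_egf P) den_unit _ _
  (fps2_egf_Li z0)).
- rewrite fps2_egf_mul_expT; apply/fpsP => n; apply/fpsP => m /=.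
  rewrite /Dmn div1r; congr (_ / _); rewrite mulr_sumr mulr_suml.
  by apply: eq_bigr => k _; rewrite PE; ring.
(* Both factors are series in t alone, so they move inside the sum over k and the identity is
   checked for each k. *)
- rewrite -(rmorph_nat lift 2) -(rmorphM lift) fps2_egf_mulr.
  rewrite -[X in _ + X](rmorph1 lift) -(rmorphD lift) fps2_egf_mulr.
  by congr fps2_egf; apply/funext => k; rewrite PM.
- by rewrite rmorphB rmorph1.
- by rewrite -rmorphM -expTD addNr expT0 rmorph1.
- by [].
Qed.
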